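(* For every integer $q\geq 2$, \[ \sum_{n=1}^\infty\frac{\binom{2n}{n}}{4^n n^{q-1}} =(-1)^q\sum_{\substack{k_1+k_2+k_3+k_4=q-1\\k_1,\ldots,k_4\geq0}}G(k_1,k_2,k_3,k_4)\,; \] in particular, this sum lies in $\mathbb{Q}[\ln 2,\zeta(2),\zeta(3),\ldots]$.
   Context: $G(k_1,k_2,k_3,k_4):=\frac{2^{k_3+k_4}\ln^{k_4}(2)\,C_{k_1}C_{k_2}D_{k_3}}{k_1!k_2!k_3!k_4!}$, where, with the exponential complete Bell polynomials $Y_n$ defined by $\exp\left(\sum_{k\geq1}x_k\frac{t^k}{k!}\right)=\sum_{n\geq0}Y_n(x_1,\ldots,x_n)\frac{t^n}{n!}$, $C_n=Y_n(x_1,\dots,x_n)$ with $x_1=0$, $x_j=(-1)^j(j-1)!\zeta(j)$ ($j\ge2$), and $D_n=Y_n(x_1,\dots,x_n)$ with $x_1=0$, $x_j=(-1)^{j-1}(j-1)!\zeta(j)$ ($j\ge2$). Equivalently $\Gamma(z+1)e^{\gamma z}=\sum C_n z^n/n!$ and $(\Gamma(z+1)e^{\gamma z})^{-1}=\sum D_nz^n/n!$. *)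

(* Defs.v *)
From mathcomp Require Import all_boot all_order all_algebra.
From mathcomp Require Import all_classical all_reals all_analysis.

Set Implicit Arguments.
Unset Strict Implicit.
Unset Printing Implicit Defensive.

Import Order.TTheory GRing.Theory Num.Theory.
Import numFieldNormedType.Exports.

Local Open Scope classical_set_scope.
Local Open Scope ring_scope.

(* For s > 1; outside this range the series diverges and the value is junk. *)
Definition zeta (R : realType) (s : R) : R := limn (series (riemannR s)).

(* Y_n(x_1, ..., x_n) is n! times the coefficient of t^n in the formal power
   series exp(\sum_(k >= 1) x_k t^k / k!) = \sum_m (\sum_(k >= 1) ...)^m / m!.
   The inner series has no constant term, so its terms with k > n and the
   powers m > n do not contribute to t^n, and both sums can be cut at n.
   The value x 0 is never used. *)
Definition bell_arg (R : realType) (x : nat -> R) (n : nat) : {poly R} :=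
  \poly_(k < n.+1) (if k == 0%N then 0 else x k / k`!%:R).

Definition bellY (R : realType) (x : nat -> R) (n : nat) : R :=
  n`!%:R * (\sum_(m < n.+1) m`!%:R^-1 *: bell_arg x n ^+ m)`_n.

Definition Cbell (R : realType) (n : nat) : R :=
  bellY (fun j => if (j <= 1)%N then 0
                  else (-1) ^+ j * (j.-1)`!%:R * zeta j%:R) n.

Definition Dbell (R : realType) (n : nat) : R :=
  bellY (fun j => if (j <= 1)%N then 0
                  else (-1) ^+ j.-1 * (j.-1)`!%:R * zeta j%:R) n.

Definition G (R : realType) (k1 k2 k3 k4 : nat) : R :=
  (2 ^+ (k3 + k4) * ln 2 ^+ k4 * Cbell R k1 * Cbell R k2 * Dbell R k3)
  / (k1`!%:R * k2`!%:R * k3`!%:R * k4`!%:R).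

(* Q[S]: the least subring of R containing the rationals and S. *)
Definition Qadjoin (R : realType) (S : set R) : set R :=
  smallest [set A : set R | GRing.subring_closed (mem A)]
           (range (@ratr R) `|` S).

Definition ln2_zetas (R : realType) : set R :=
  [set ln 2] `|` [set zeta j%:R | j in [set j : nat | (2 <= j)%N]].
Arguments ln2_zetas : clear implicits.

Definition binom_series (R : realType) (q : nat) : R^nat :=
  fun N => \sum_(1 <= n < N) 'C(2 * n, n)%:R / (4 ^+ n * n%:R ^+ (q - 1)).

(* Main.v *)
(* With b_n = C(2n,n)/4^n, the generating function of the sums is
     1 + \sum_(m >= 1) (-1)^(m-1) (\sum_n b_n / n^m) z^m
       = Gamma(1+z) sqrt(pi) / Gamma(z+1/2) = 4^z Gamma(1+z)^2 / Gamma(1+2z).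
   Gamma is avoided by truncating the infinite product: the coefficients of
   \prod_(k <= N) (1 + z/(k-1/2)) / (1 + z/k) are, up to sign, the sums
   \sum_(n <= N) (b_n b_(N-n) / b_N) / n^m given by its partial fractions, and
   these are squeezed against the partial sums of the series. On the other side,
   the logarithmic derivative of the truncated product has as coefficients
   differences of harmonic numbers, which converge to 2 ln 2 and to
   (2^j - 2) zeta(j), up to sign; these are the coefficients of the logarithmic
   derivative of the product of the Bell series. Power series are represented
   by polynomials modulo z^M, and a series with constant term 1 is determined
   by, and depends continuously on, its logarithmic derivative. *)
Require Import Defs.
From HB Require Import structures.
From mathcomp Require Import all_boot all_order all_algebra.
From mathcomp Require Import all_classical all_reals all_analysis.
From mathcomp Require Import ring lra zify.

Import Order.TTheory GRing.Theory Num.Theory.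
Import numFieldNormedType.Exports.

Local Open Scope classical_set_scope.
Local Open Scope ring_scope.

(** * Power series modulo ['X^M] and their logarithmic derivatives *)

Lemma dvdXnP (R : fieldType) (M : nat) (p : {poly R}) :
  reflect (forall i, (i < M)%N -> p`_i = 0) ('X^M %| p).
Proof.
apply: (iffP idP) => [/dvdpP[q ->] i iM|p0]; first by rewrite coefMXn iM.
rewrite -(poly_take_drop M p) dvdp_addl ?dvdp_mull //.
suff -> : take_poly M p = 0 by rewrite dvdp0.
by apply/polyP => i; rewrite coef_take_poly coef0; case: ifP => // /p0.
Qed.

(* [x] is the logarithmic derivative z u'(z) / u(z) of [u], modulo z^M. *)
Definition zlogder {R : fieldType} (M : nat) (x u : {poly R}) : Prop :=
  'X^M %| 'X * u^`() - x * u.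

Lemma zlogder_coef (R : fieldType) (M : nat) (x u : {poly R}) :
  zlogder M x u <->
  forall m, (m < M)%N -> m%:R * u`_m = \sum_(j < m.+1) x`_(m - j) * u`_j.
Proof.
have E m : ('X * u^`() - x * u)`_m
    = m%:R * u`_m - \sum_(j < m.+1) x`_(m - j) * u`_j.
  rewrite coefB coefXM coefMr; case: m => [|m] /=; first by rewrite mul0r.
  by rewrite coef_deriv mulr_natl.
split=> [/dvdXnP H m /H /eqP|H]; first by rewrite E subr_eq0 => /eqP.
by apply/dvdXnP => m /H; rewrite E => ->; rewrite subrr.
Qed.

Lemma zlogder1 (R : fieldType) (M : nat) : zlogder M 0 (1 : {poly R}).
Proof. by rewrite /zlogder mul0r subr0 -[1]/(1%:P) derivC mulr0 dvdp0. Qed.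

Lemma zlogderM (R : fieldType) (M : nat) (x y u v : {poly R}) :
  zlogder M x u -> zlogder M y v -> zlogder M (x + y) (u * v).
Proof.
rewrite /zlogder => xu yv; rewrite derivM.
have -> : 'X * (u^`() * v + u * v^`()) - (x + y) * (u * v)
  = v * ('X * u^`() - x * u) + u * ('X * v^`() - y * v) by ring.
by rewrite dvdp_add // dvdp_mull.
Qed.

Lemma zlogder_prod (R : fieldType) (M N : nat) (x u : nat -> {poly R}) :
  (forall k, zlogder M (x k) (u k)) ->
  zlogder M (\sum_(k < N) x k) (\prod_(k < N) u k).
Proof.
move=> xu; elim: N => [|N IH]; first by rewrite !big_ord0; exact: zlogder1.
by rewrite !big_ord_recr; exact: zlogderM.
Qed.

(** The inverse of 1 + c z modulo z^M. *)
Definition geom {R : fieldType} (M : nat) (c : R) : {poly R} :=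
  \poly_(j < M) (- c) ^+ j.

Lemma geomE (R : fieldType) (M : nat) (c : R) :
  (1 + c *: 'X) * geom M c = 1 - (- c) ^+ M *: 'X^M.
Proof.
rewrite /geom poly_def.
under eq_bigr do rewrite -exprZn.
have -> : 1 + c *: 'X = 1 - (- c) *: 'X :> {poly R} by rewrite scaleNr opprK.
rewrite -exprZn -[RHS]opprB subrX1; ring.
Qed.

Lemma zlogder_linear (R : fieldType) (M : nat) (c : R) :
  zlogder M (c *: 'X * geom M c) (1 + c *: 'X).
Proof.
rewrite /zlogder derivD derivZ derivX derivC add0r.
have -> : 'X * (c *: 1) - c *: 'X * geom M c * (1 + c *: 'X)
  = c *: 'X - (c *: 'X) * ((1 + c *: 'X) * geom M c).
  by rewrite -!mul_polyC; ring.
rewrite geomE -!mul_polyC.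
have -> : c%:P * 'X - c%:P * 'X * (1 - ((- c) ^+ M)%:P * 'X^M)
  = c%:P * 'X * ((- c) ^+ M)%:P * 'X^M :> {poly R} by ring.
by rewrite dvdp_mull.
Qed.

(** As [geom] is an inverse only modulo z^M, the identity [geomE] is differentiated; z times the
    derivative of z^M is again a multiple of z^M, so every error term is divisible by z^M. *)
Lemma zlogder_geom (R : fieldType) (M : nat) (c : R) :
  zlogder M (- (c *: 'X * geom M c)) (geom M c).
Proof.
have E := geomE R M c; have /(congr1 (@deriv R)) dE := E; move: E dE.
rewrite derivM !derivD derivN derivC !derivZ derivX derivXn /zlogder.
rewrite -!mul_polyC add0r sub0r mulr1.
set g := geom M c; set d := ((- c) ^+ M)%:P => E dE.
have XM : ('X * 'X^(M.-1)) *+ M = M%:R * 'X^M :> {poly R}.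
  by case: (M) => [|m]; rewrite ?mulr0n ?mul0r //= -exprS mulr_natl.
(* The first bracket is d z^M by [E]; the second is the derivative of (1 + c z) g, known from
   [dE]. *)
have -> : 'X * g^`() - - (c%:P * 'X * g) * g =
  'X * g^`() * (1 - (1 + c%:P * 'X) * g)
  + 'X * g * (c%:P * g + (1 + c%:P * 'X) * g^`()) by ring.
rewrite E dE opprB [1 + _]addrC subrK mulrA; apply: dvdp_add; first by rewrite dvdp_mull.
rewrite mulrN -mulNr.
have -> : - ('X * g) * (d * ('X^(M.-1) *+ M)) = - g * d * (('X * 'X^(M.-1)) *+ M).
  by rewrite -!mulrnAr; ring.
by rewrite XM !mulrA dvdp_mull.
Qed.

Lemma zlogder_eq (R : fieldType) (M : nat) (x y u : {poly R}) :
  (forall i, (i < M)%N -> x`_i = y`_i) -> zlogder M x u -> zlogder M y u.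
Proof.
move=> xy /zlogder_coef xu; apply/zlogder_coef => m mM; rewrite xu //.
by apply: eq_bigr => j _; rewrite xy // (leq_ltn_trans (leq_subr _ _)).
Qed.

Lemma zlogder_eqr (R : fieldType) (M : nat) (x u v : {poly R}) :
  (forall i, (i < M)%N -> u`_i = v`_i) -> zlogder M x u -> zlogder M x v.
Proof.
move=> uv /zlogder_coef xu; apply/zlogder_coef => m mM; rewrite -uv // xu //.
by apply: eq_bigr => j _; rewrite uv // (leq_trans (ltn_ord j)).
Qed.

(** As x has no constant term, [zlogder_coef] expresses m u_m through u_j with j < m, and m is
    invertible. *)
Lemma zlogder_uniq (R : numFieldType) (M : nat) (x u v : {poly R}) :
  x`_0 = 0 -> u`_0 = v`_0 -> zlogder M x u -> zlogder M x v ->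
  forall m, (m < M)%N -> u`_m = v`_m.
Proof.
move=> x0 uv0 /zlogder_coef xu /zlogder_coef xv; elim/ltn_ind => -[//|m] IH mM.
apply: (@mulfI _ m.+1%:R); first by rewrite pnatr_eq0.
rewrite xu // xv //; apply: eq_bigr => j _.
have := ltn_ord j; rewrite ltnS leq_eqVlt => /orP[/eqP ->|jm].
  by rewrite subnn x0 !mul0r.
by rewrite IH // (ltn_trans jm).
Qed.

(** The recurrence behind [zlogder_uniq] makes each coefficient of u a polynomial in finitely many
    coefficients of x, so limits pass from x to u by induction on m. *)
Lemma zlogder_cvg (R : realType) (M : nat) (x u : nat -> {poly R})
    (y v : {poly R}) :
  (forall N, zlogder M (x N) (u N)) -> zlogder M y v ->
  (forall N, (x N)`_0 = 0) -> (forall N, (u N)`_0 = 1) ->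
  y`_0 = 0 -> v`_0 = 1 ->
  (forall j, (0 < j < M)%N -> (x N)`_j @[N --> \oo] --> y`_j) ->
  forall m, (m < M)%N -> (u N)`_m @[N --> \oo] --> v`_m.
Proof.
move=> xu /zlogder_coef yv x0 u0 y0 v0 xy; elim/ltn_ind => -[_ _|m IH mM].
  by rewrite v0; under eq_fun do rewrite u0; exact: cvg_cst.
have m0 : m.+1%:R != 0 :> R by rewrite pnatr_eq0.
have -> : v`_m.+1 = m.+1%:R^-1 * \sum_(j < m.+2) y`_(m.+1 - j) * v`_j.
  by rewrite -yv // mulKf.
under eq_fun => N.
  have /zlogder_coef/(_ _ mM) E := xu N.
  rewrite -[(u N)`_m.+1](mulKf m0) E.
  over.
apply: cvgMl_tmp; apply: cvg_big => [|j _]; first exact: add_continuous.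
have := ltn_ord j; rewrite ltnS leq_eqVlt => /orP[/eqP ->|jm].
  rewrite subnn y0 mul0r; under eq_fun do rewrite x0 mul0r; exact: cvg_cst.
apply: cvgM; last by apply: IH => //; exact: ltn_trans mM.
by apply: xy; rewrite subn_gt0 jm (leq_ltn_trans (leq_subr _ _)).
Qed.

Lemma zlogderW (R : fieldType) (M N : nat) (x u : {poly R}) :
  (M <= N)%N -> zlogder N x u -> zlogder M x u.
Proof. by move=> MN; apply: dvdp_trans; rewrite -(subnK MN) exprD dvdp_mull. Qed.

(** The substitution of c z for z commutes with z d/dz. *)
Lemma zlogder_scale (R : fieldType) (M : nat) (c : R) (x u : {poly R}) :
  zlogder M x u ->
  zlogder M (\poly_(j < M) (c ^+ j * x`_j)) (\poly_(j < M) (c ^+ j * u`_j)).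
Proof.
move=> /zlogder_coef xu; apply/zlogder_coef => m mM.
rewrite coef_poly mM mulrCA xu // mulr_sumr; apply: eq_bigr => j _.
have jm : (j <= m)%N by rewrite -ltnS.
rewrite !coef_poly (leq_ltn_trans jm mM) (leq_ltn_trans (leq_subr _ _) mM).
by rewrite -{1}(subnK jm) exprD; ring.
Qed.

Lemma zlogder_exp (R : numFieldType) (M : nat) (c : R) :
  zlogder M (c *: 'X) (\poly_(j < M) (c ^+ j / j`!%:R)).
Proof.
apply/dvdXnP => m mM; rewrite coefB coefXM coef_deriv -scalerAl coefZ coefXM.
case: m mM => [|m] mM /=; first by rewrite mulr0 subrr.
rewrite !coef_poly mM (ltnW mM) -mulr_natr factS natrM exprS.
have ? : m.+1%:R != 0 :> R by rewrite pnatr_eq0.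
have ? : m`!%:R != 0 :> R by rewrite pnatr_eq0 -lt0n fact_gt0.
by field; apply/andP.
Qed.

(** * Truncated exponentials and Bell polynomials *)

Definition exp_trunc {R : fieldType} (n : nat) (g : {poly R}) : {poly R} :=
  \sum_(m < n.+1) m`!%:R^-1 *: g ^+ m.

Lemma exp_trunc0 (R : numFieldType) (n : nat) (g : {poly R}) :
  g`_0 = 0 -> (exp_trunc n g)`_0 = 1.
Proof.
move=> g0; rewrite /exp_trunc big_ord_recl expr0 coefD coefZ coef1 fact0 invr1.
rewrite mulr1 coef_sum big1 ?addr0 // => i _.
by rewrite coefZ exprS coef0M g0 mul0r mulr0.
Qed.

(** Differentiation reproduces g' times the truncated exponential except for its last term g^n / n!,
    and z g^n is divisible by z^(n+1) because g(0) = 0. *)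
Lemma zlogder_exp_trunc (R : numFieldType) (n : nat) (g : {poly R}) :
  g`_0 = 0 -> zlogder n.+1 ('X * g^`()) (exp_trunc n g).
Proof.
move=> g0; have Xg : 'X %| g.
  by rewrite -['X]expr1; apply/dvdXnP => -[].
have dE : (exp_trunc n g)^`() = g^`() * \sum_(m < n) m`!%:R^-1 *: g ^+ m.
  rewrite /exp_trunc raddf_sum big_ord_recl /= expr0 linearZ /= derivC scaler0.
  rewrite add0r mulr_sumr; apply: eq_bigr => m _.
  rewrite derivZ deriv_exp -[bump 0 m]/m.+1 /= -scalerAr.
  rewrite -[_ *+ m.+1]scaler_nat scalerA; congr (_ *: _).
  by rewrite factS natrM invfM mulrAC mulVf ?mul1r ?pnatr_eq0.
have W : exp_trunc n g = \sum_(m < n) m`!%:R^-1 *: g ^+ m + n`!%:R^-1 *: g ^+ n.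
  by rewrite /exp_trunc big_ord_recr.
rewrite /zlogder dE W; set S := \sum_(m < n) _.
have -> : 'X * (g^`() * S) - 'X * g^`() * (S + n`!%:R^-1 *: g ^+ n)
    = - (g^`() * (n`!%:R^-1)%:P) * ('X * g ^+ n).
  by rewrite -mul_polyC; ring.
by rewrite dvdp_mull // exprS dvdp_mul // dvdp_exp2r.
Qed.

(** [bellY x k] is cut at k, whereas a generating polynomial needs one cut n for all k. The two
    exponentials have the same logarithmic derivative modulo z^(k+1), so [zlogder_uniq] identifies
    their coefficients. *)
Lemma bell_coef (R : realType) (x : nat -> R) (n k : nat) :
  (k <= n)%N -> (exp_trunc n (bell_arg x n))`_k = bellY x k / k`!%:R.
Proof.
move=> kn; have kf : k`!%:R != 0 :> R by rewrite pnatr_eq0 -lt0n fact_gt0.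
have arg0 m : (bell_arg x m)`_0 = 0 by rewrite coef_poly.
rewrite /bellY mulrAC mulfV // mul1r -/(exp_trunc k (bell_arg x k)).
apply: (@zlogder_uniq _ k.+1 ('X * (bell_arg x n)^`())) => //.
- by rewrite coefXM.
- by rewrite !exp_trunc0.
- by apply: zlogderW (zlogder_exp_trunc _ _ _ _).
- apply: zlogder_eq (zlogder_exp_trunc _ _ _ (arg0 k)) => i ik.
  rewrite !coefXM !coef_deriv !coef_poly; case: i ik => //= i ik.
  by rewrite ik (leq_trans ik).
Qed.

Lemma zlogder_bell (R : realType) (x : nat -> R) (M : nat) :
  zlogder M (\poly_(j < M) (if j == 0%N then 0 else x j / (j.-1)`!%:R))
    (\poly_(k < M) (bellY x k / k`!%:R)).
Proof.
case: M => [|n]; first by rewrite /zlogder expr0 dvd1p.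
have arg0 : (bell_arg x n)`_0 = 0 by rewrite coef_poly.
apply: (@zlogder_eqr _ _ _ (exp_trunc n (bell_arg x n))) => [i iN|].
  by rewrite coef_poly iN bell_coef.
apply: zlogder_eq (zlogder_exp_trunc _ _ _ arg0) => i iN.
rewrite coefXM coef_deriv !coef_poly iN; case: i iN => //= i iN.
rewrite iN -[_ *+ i.+1]mulr_natr factS natrM -mulrA invfM; congr (_ * _).
by rewrite mulrAC mulVf ?mul1r // pnatr_eq0.
Qed.

(** * The weights b_n = C(2n,n)/4^n *)

Definition cbin (R : realType) (n : nat) : R := 'C(2 * n, n)%:R / 4 ^+ n.

Lemma cbin0 (R : realType) : cbin R 0 = 1.
Proof. by rewrite /cbin muln0 bin0 expr0 divr1. Qed.

Lemma cbinS (R : realType) (n : nat) :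
  n.+1%:R * cbin R n.+1 = (n%:R + 2^-1) * cbin R n.
Proof.
have H : (n.+1 * 'C(2 * n.+1, n.+1) = 2 * (2 * n).+1 * 'C(2 * n, n))%N.
  have E1 := mul_bin_diag (2 * n).+2 n.
  have E2 := mul_bin_left (2 * n).+1 n.
  have E3 := mul_bin_diag (2 * n).+1 n.
  (* The two middle coefficients of row 2n+1 coincide. *)
  have E4 : (n.+1 * 'C((2 * n).+1, n) = n.+1 * 'C((2 * n).+1, n.+1))%N.
    by rewrite E2; congr (_ * _)%N; lia.
  have -> : (2 * n.+1 = (2 * n).+2)%N by lia.
  rewrite -E1 /=; apply/eqP; rewrite -(eqn_pmul2l (ltn0Sn n)); apply/eqP.
  rewrite /= in E3; move: E3 E4; move: 'C(_, _) 'C(_, _) 'C(_, _) => a b c; nia.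
have /(congr1 (fun k : nat => k%:R : R)) := H.
rewrite !natrM /cbin exprS => E.
have ? : 4 ^+ n != 0 :> R by rewrite expf_neq0 ?pnatr_eq0.
have -> : n.+1%:R * ('C(2 * n.+1, n.+1)%:R / (4 * 4 ^+ n)) =
  n.+1%:R * 'C(2 * n.+1, n.+1)%:R / (4 * 4 ^+ n) :> R by rewrite mulrA.
by rewrite E -[(2 * n).+1%:R]natr1 natrM; field.
Qed.

Lemma cbin_gt0 (R : realType) (n : nat) : 0 < cbin R n.
Proof.
by rewrite /cbin divr_gt0 ?exprn_gt0 ?ltr0n // bin_gt0 mul2n -addnn leq_addl.
Qed.

Lemma cbinSE (R : realType) (n : nat) :
  cbin R n.+1 = (n%:R + 2^-1) / n.+1%:R * cbin R n.
Proof. by rewrite mulrAC -cbinS mulrAC mulfV ?mul1r // pnatr_eq0. Qed.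

(** The generating function of b_n is (1-t)^(-1/2), whose square is 1/(1-t). The proof uses only
    [cbinS] and the symmetry of the convolution. *)
Lemma cbin_conv (R : realType) (n : nat) :
  \sum_(i < n.+1) cbin R i * cbin R (n - i) = 1.
Proof.
elim: n => [|n IH]; first by rewrite big_ord1 cbin0 mulr1.
apply: (@mulfI _ n.+1%:R); first by rewrite pnatr_eq0.
set S := \sum_(i < n.+2) _.
set T := \sum_(i < n.+2) i%:R * cbin R i * cbin R (n.+1 - i).
have revT : T = \sum_(i < n.+2) (n.+1 - i)%:R * (cbin R i * cbin R (n.+1 - i)).
  rewrite /T (reindex_inj rev_ord_inj); apply: eq_bigr => i _ /=.
  rewrite subSS subKn; last by rewrite -ltnS.
  by rewrite -mulrA [cbin R i * _]mulrC.
have -> : n.+1%:R * S = 2 * T.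
  rewrite [RHS]mulr_natl [RHS]mulr2n [X in _ + X]revT -big_split mulr_sumr.
  by apply: eq_bigr => i _ /=; rewrite natrB; [ring | rewrite -ltnS].
rewrite /T big_ord_recl mul0r mul0r add0r mulr1.
under eq_bigr => i _.
  rewrite /= /bump /= add1n cbinS subSS.
  over.
have -> : n.+1%:R = \sum_(i < n.+1) n.+1%:R * (cbin R i * cbin R (n - i)).
  by rewrite -mulr_sumr IH mulr1.
rewrite mulr_sumr.
(* One of the two copies is reversed, and (i + 1/2) + (n - i + 1/2) = n + 1. *)
have {1}-> : \sum_(i < n.+1) 2 * ((i%:R + 2^-1) * cbin R i * cbin R (n - i))
  = \sum_(i < n.+1) (i%:R + 2^-1) * cbin R i * cbin R (n - i)
  + \sum_(i < n.+1) (i%:R + 2^-1) * cbin R i * cbin R (n - i).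
  by rewrite -big_split; apply: eq_bigr => i _ /=; ring.
rewrite [X in X + _](reindex_inj rev_ord_inj) -big_split.
apply: eq_bigr => i _ /=; rewrite subSS.
have ilen : (i <= n)%N by rewrite -ltnS.
by rewrite subKn // natrB // -natr1; field.
Qed.

Lemma cbin_nonincreasing (R : realType) (m n : nat) :
  (m <= n)%N -> cbin R n <= cbin R m.
Proof.
move/subnK <-; elim: (n - m)%N => [//|k IH]; apply: le_trans IH.
rewrite addSn cbinSE ler_piMl //; first by rewrite ltW ?cbin_gt0.
rewrite ler_pdivrMr ?ltr0n // mul1r.
by rewrite -[in leRHS]natr1 lerD2l invf_le1 ?ler1n ?ltr0n.
Qed.

Lemma mul_cbin_nondecreasing (R : realType) (m n : nat) :
  (m <= n)%N -> m%:R * cbin R m <= n%:R * cbin R n.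
Proof.
move/subnK <-; elim: (n - m)%N => [//|k IH]; apply: (le_trans IH).
rewrite addSn cbinS ler_wpM2r //; first by rewrite ltW ?cbin_gt0.
rewrite lerDl invr_ge0.
exact: ler0n.
Qed.

(** The quotient (n b_n)^2 / n is nondecreasing and equals 1/4 at n = 1; hence n b_n grows at least
    like sqrt(n)/2. *)
Lemma cbin_sqr_ge (R : realType) (n : nat) :
  (0 < n)%N -> n%:R <= 4 * (n%:R * cbin R n) ^+ 2.
Proof.
case: n => // n _; elim: n => [|n IH].
  by rewrite cbinS cbin0; lra.
rewrite cbinS; move: IH; rewrite -[n.+2%:R]natr1 -natr1.
move: (n%:R) (ler0n R n) (cbin _ _) => x x0 b H.
have x1 : 0 < x + 1 by lra.
rewrite -(ler_pM2r (exprn_gt0 2 x1)).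
(* With y = x + 1 this is y (y + 1) <= (y + 1/2)^2, multiplied by y. *)
apply: (@le_trans _ _ ((x + 1 + 2^-1) ^+ 2 * (x + 1))); first by nra.
have -> : 4 * ((x + 1 + 2^-1) * b) ^+ 2 * (x + 1) ^+ 2
  = (x + 1 + 2^-1) ^+ 2 * (4 * ((x + 1) * b) ^+ 2) by ring.
by rewrite ler_wpM2l // sqr_ge0.
Qed.

Lemma cvg_inv_mul_cbin (R : realType) :
  (N%:R * cbin R N)^-1 @[N --> \oo] --> (0 : R).
Proof.
apply/cvgr0Pnorm_lt => e e0; near=> N.
have N0 : (0 < N)%N by near: N; exact: nbhs_infty_gt.
have b0 : 0 < N%:R * cbin R N by rewrite mulr_gt0 ?cbin_gt0 ?ltr0n.
rewrite ger0_norm ?invr_ge0 ?ltW // invf_plt ?posrE //.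
rewrite -(@ltr_pXn2r _ 2) ?nnegrE ?invr_ge0 ?ltW //.
rewrite -(ltr_pM2l (ltr0n R 4)); apply: lt_le_trans (cbin_sqr_ge R N N0).
by near: N; exact: nbhs_infty_gtr.
Unshelve. all: by end_near. Qed.

(** * The partial-fraction sums, compared with the series *)

Definition dsum (R : realType) (N m : nat) : R :=
  \sum_(1 <= n < N.+1) cbin R n * cbin R (N - n) / cbin R N / n%:R ^+ m.

Lemma dsum0 (R : realType) (N : nat) : dsum R N 0 = (cbin R N)^-1 - 1.
Proof.
have b0 : cbin R N != 0 by rewrite gt_eqF ?cbin_gt0.
have := cbin_conv R N; rewrite -(big_mkord xpredT (fun i => cbin R i * cbin R (N - i))).
rewrite big_ltn // cbin0 mul1r subn0 => /(congr1 (fun t => t / cbin R N)).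
rewrite mulrDl mulfV // mul1r mulr_suml => <-.
by rewrite addrAC subrr add0r; apply: eq_bigr => i _; rewrite expr0 divr1.
Qed.

(** Up to sign this is the recurrence that (1 + z/(N+1)) P_(N+1) = (1 + z/(N+1/2)) P_N imposes on
    the coefficients of the truncated product P_N. It holds term by term. *)
Lemma dsum_rec (R : realType) (N m : nat) :
  dsum R N.+1 m.+1 - dsum R N.+1 m / N.+1%:R =
  dsum R N m.+1 - dsum R N m / (N%:R + 2^-1).
Proof.
rewrite /dsum !mulr_suml -!sumrB big_nat_recr //= subnn cbin0.
(* The extra term n = N+1 cancels on the left. *)
set A := (X in _ + X); have -> : A = 0.
  by rewrite /A [N.+1%:R ^+ m.+1]exprSr [(_ ^+ m * _)^-1]invfM mulrA subrr.
rewrite addr0; apply: eq_big_nat => i /andP[i0]; rewrite ltnS => iN.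
rewrite subSn // !cbinSE exprS.
rewrite -[N.+1%:R]natr1 -[(N - i).+1%:R]natr1.
have -> : N%:R = (N - i)%:R + i%:R :> R by rewrite -natrD subnK.
have iR0 : i%:R != 0 :> R by rewrite pnatr_eq0 -lt0n.
have bN0 : cbin R N != 0 by rewrite gt_eqF ?cbin_gt0.
move: (i%:R) iR0 (ler0n R i) ((N - i)%:R) (ler0n R (N - i)).
move: (cbin R N) bN0 (cbin R i) (cbin R (N - i)) => bN bN0 bi bNi x xn0 x0 k k0.
have k1 : k + 1 != 0 by rewrite gt_eqF //; lra.
have kx1 : k + x + 1 != 0 by rewrite gt_eqF //; lra.
have kx2 : (k + x) * 2 + 1 != 0 by rewrite gt_eqF //; lra.
by field; rewrite kx2 expf_neq0 // bN0 xn0 kx1.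
Qed.

Lemma binom_seriesE (R : realType) (m N : nat) :
  binom_series R m.+1 N = \sum_(1 <= n < N) cbin R n / n%:R ^+ m.
Proof.
by apply: eq_bigr => n _; rewrite /cbin subn1 invfM mulrA.
Qed.

(** Since b_n decreases, each factor b_(N-n)/b_N is at least 1. *)
Lemma binom_series_le_dsum (R : realType) (m N : nat) :
  binom_series R m.+1 N.+1 <= dsum R N m.
Proof.
rewrite binom_seriesE; apply: ler_sum_nat => n /andP[n0 nN].
rewrite ler_wpM2r ?invr_ge0 ?exprn_ge0 //.
rewrite ler_pdivlMr ?cbin_gt0 // ler_wpM2l ?(ltW (cbin_gt0 _ _)) //.
by rewrite cbin_nonincreasing // leq_subr.
Qed.

(* The weight b_(N-n)/b_N is close to 1 except near n = N; writing
   1/n = (N - n)/(N n) + 1/N splits off that part, as (N - n) b_(N-n) <= N b_N. *)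
Lemma dsum_le_binom_series (R : realType) (m N : nat) :
  (0 < N)%N ->
  dsum R N m.+1 <= binom_series R m.+2 N.+1 + (N%:R * cbin R N)^-1.
Proof.
move=> N0; have b0 := cbin_gt0 R N; have NR : 0 < N%:R :> R by rewrite ltr0n.
rewrite binom_seriesE.
(* In the part carrying 1/N, the factor n^m >= 1 is dropped and [dsum0] evaluates what remains. *)
apply: (@le_trans _ _ (\sum_(1 <= n < N.+1) cbin R n / n%:R ^+ m.+1
    + dsum R N 0 / N%:R)); last first.
  rewrite lerD2l dsum0 [(N%:R * _)^-1]invfM [N%:R^-1 * _]mulrC.
  by rewrite ler_wpM2r ?invr_ge0 ?(ltW NR) // gerBl.
rewrite mulr_suml -big_split; apply: ler_sum_nat => n /andP[n0]; rewrite ltnS => nN.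
rewrite expr0 divr1 /=.
have nR : 1 <= n%:R :> R by rewrite ler1n.
have nNR : n%:R <= N%:R :> R by rewrite ler_nat.
have := mul_cbin_nondecreasing R _ _ (leq_subr n N); rewrite natrB // => H.
have nm : 1 <= n%:R ^+ m :> R by rewrite exprn_ege1.
have bn := cbin_gt0 R n; have bNn := cbin_gt0 R (N - n).
have n0R : 0 < n%:R :> R by rewrite ltr0n.
have nm0 : 0 < n%:R ^+ m :> R by rewrite exprn_gt0.
have -> : cbin R n * cbin R (N - n) / cbin R N / n%:R ^+ m.+1
  = cbin R n / n%:R ^+ m.+1 * (((N%:R - n%:R) * cbin R (N - n)) / (N%:R * cbin R N))
  + cbin R n * cbin R (N - n) / cbin R N / N%:R / n%:R ^+ m.
  by rewrite exprS; field; rewrite !gt_eqF.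
apply: lerD.
  rewrite ler_piMr ?divr_ge0 ?exprn_ge0 ?(ltW bn) //.
  by rewrite ler_pdivrMr; [rewrite mul1r | exact: mulr_gt0].
rewrite ler_pdivrMr // ler_peMr //.
by rewrite divr_ge0 ?(ltW NR) // divr_ge0 ?(ltW b0) // mulr_ge0 ?ltW.
Qed.

(** * The truncated product and its coefficients *)

Definition gamma_trunc (R : realType) (M N : nat) : {poly R} :=
  \prod_(k < N) ((1 + (k%:R + 2^-1)^-1 *: 'X) * geom M (k.+1%:R^-1)).

Lemma gamma_trunc_rec (R : realType) (M N m : nat) : (m.+1 < M)%N ->
  (gamma_trunc R M N.+1)`_m.+1 + (gamma_trunc R M N.+1)`_m / N.+1%:R =
  (gamma_trunc R M N)`_m.+1 + (gamma_trunc R M N)`_m / (N%:R + 2^-1).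
Proof.
move=> mM; set P := gamma_trunc R M N; set c := (N%:R + 2^-1)^-1.
set d := N.+1%:R^-1.
have E : (1 + d *: 'X) * gamma_trunc R M N.+1
    = P * (1 + c *: 'X) * (1 - (- d) ^+ M *: 'X^M).
  rewrite -geomE /gamma_trunc big_ord_recr /= -/P -/c -/d.
  by rewrite mulrCA -mulrA [_ * (_ * geom _ _)]mulrCA.
have /(congr1 (fun p : {poly R} => p`_m.+1)) := E.
rewrite mulrDl mul1r coefD -scalerAl coefZ coefXM /= [d * _]mulrC => ->.
rewrite mulrBr mulr1 coefB -scalerAr coefZ coefMXn mM mulr0 subr0.
by rewrite mulrDr mulr1 coefD -scalerAr coefZ coefMX /= [c * _]mulrC.
Qed.

Lemma gamma_trunc0 (R : realType) (M N : nat) :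
  (0 < M)%N -> (gamma_trunc R M N)`_0 = 1.
Proof.
move=> M0; rewrite /gamma_trunc; elim: N => [|N IH]; first by rewrite big_ord0 coef1.
rewrite big_ord_recr /= !coef0M IH coefD coef1 coefZ coefX mulr0 addr0.
by rewrite coef_poly M0 expr0 !mul1r.
Qed.

(** Partial fractions are verified rather than derived: both sides obey the same recurrence, by
    induction on N and, inside, on m. *)
Lemma gamma_trunc_coef (R : realType) (M N m : nat) : (m.+1 < M)%N ->
  (gamma_trunc R M N)`_m.+1 = (-1) ^+ m * dsum R N m.+1.
Proof.
elim: N m => [m mM|N IHN].
  by rewrite /gamma_trunc /dsum big_ord0 big_geq // coef1 mulr0.
have half0 : N%:R + 2^-1 != 0 :> R by rewrite gt_eqF // ltr_wpDl ?ler0n.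
elim=> [|m IHm] mM.
  (* The constant coefficient 1 exceeds the pattern value -[dsum R N 0] by 1/b_N; these excesses
     balance because (N+1) b_(N+1) = (N + 1/2) b_N. *)
  have := gamma_trunc_rec R M N 0 mM; rewrite !gamma_trunc0 ?(ltnW mM) //.
  move/(canRL (addrK _)) ->; rewrite IHN // !expr0 !mul1r.
  have := dsum_rec R N 0; rewrite !dsum0 => E.
  have := cbinSE R N => bE.
  have -> : dsum R N 1 = dsum R N.+1 1 - ((cbin R N.+1)^-1 - 1) / N.+1%:R
    + ((cbin R N)^-1 - 1) / (N%:R + 2^-1) by rewrite E; ring.
  rewrite bE.
  have b0 : cbin R N != 0 by rewrite gt_eqF ?cbin_gt0.
  have N1 : N.+1%:R != 0 :> R by rewrite pnatr_eq0.
  move: (cbin R N) (dsum R N.+1 1) N.+1%:R b0 N1 half0 => b s k b0 k0.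
  move: (N%:R + 2^-1) => h h0; field; rewrite b0 k0 h0 //.
have := gamma_trunc_rec R M N m.+1 mM; move/(canRL (addrK _)) ->.
rewrite IHN // IHm ?(ltnW mM) // IHN ?(ltnW mM) // !exprS.
have := dsum_rec R N m.+1 => E.
have -> : dsum R N m.+2 = dsum R N.+1 m.+2 - dsum R N.+1 m.+1 / N.+1%:R
    + dsum R N m.+1 / (N%:R + 2^-1) by rewrite E; ring.
ring.
Qed.

(** * Harmonic sums and their limits *)

Definition pharm (R : realType) (j N : nat) : R := \sum_(k < N) k.+1%:R^-1 ^+ j.

Lemma pharmS (R : realType) (j N : nat) :
  pharm R j N.+1 = pharm R j N + N.+1%:R^-1 ^+ j.
Proof. exact: big_ord_recr. Qed.

(** The numbers k + 1/2 are halves of the odd numbers, and the sum over odd denominators is the sum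
    up to 2N minus its even part, which rescales to [pharm R j N]. *)
Lemma pharm_half (R : realType) (j N : nat) :
  \sum_(k < N) ((k%:R + 2^-1)^-1 ^+ j - k.+1%:R^-1 ^+ j) =
  2 ^+ j * pharm R j (2 * N) - 2 * pharm R j N.
Proof.
elim: N => [|N IH]; first by rewrite big_ord0 /pharm big_ord0 !mulr0 subrr.
rewrite big_ord_recr /= IH (_ : (2 * N.+1 = (2 * N).+2)%N); last by lia.
rewrite !pharmS.
have -> : (N%:R + 2^-1)^-1 = 2 * (2 * N).+1%:R^-1 :> R.
  have := ler0n R N; rewrite -[(2 * N).+1%:R]natr1 natrM; move: (N%:R) => x x0.
  by field; rewrite !gt_eqF //; lra.
have -> : N.+1%:R^-1 = 2 * (2 * N).+2%:R^-1 :> R.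
  rewrite -[(2 * N).+2%:R]natr1 -[(2 * N).+1%:R]natr1 -[N.+1%:R]natr1
    natrM; have := ler0n R N.
  move: (N%:R) => x x0.
  by field; rewrite !gt_eqF //; lra.
by rewrite !exprMn; ring.
Qed.

Lemma cvg_pharm (R : realType) (j : nat) :
  (2 <= j)%N -> pharm R j N @[N --> \oo] --> zeta (j%:R : R).
Proof.
move=> j2; have -> : pharm R j = series (riemannR (j%:R : R)).
  apply/funext => N; rewrite /pharm /series /= big_mkord; apply: eq_bigr => k _.
  by rewrite /riemannR powR_mulrn // exprVn.
suff : cvgn (series (riemannR (j%:R : R))) by [].
have r0 k : 0 <= riemannR (j%:R : R) k by rewrite ltW // riemannR_gt0.
(* Telescoping bound from 1/(x+1)^2 <= 1/x - 1/(x+1). *)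
have B N : series (riemannR (j%:R : R)) N.+1 <= 2 - N.+1%:R^-1.
  elim: N => [|N IH].
    rewrite /series /= big_nat1 /riemannR powR1 invr1; lra.
  rewrite /series /= big_nat_recr //=.
  apply: (@le_trans _ _ (2 - N.+1%:R^-1 + (N.+2%:R ^+ 2)^-1)).
    apply: lerD; first exact: IH.
    rewrite /riemannR powR_mulrn // lef_pV2 ?posrE ?exprn_gt0 ?ltr0n //.
    by rewrite ler_weXn2l // ler1n.
  rewrite -[N.+2%:R]natr1; move: N.+1%:R (ltr0Sn R N) => x x0.
  have -> : 2 - x^-1 + ((x + 1) ^+ 2)^-1 =
     2 - (x + 1)^-1 - (x * (x + 1) ^+ 2)^-1.
    by field; rewrite !gt_eqF //; lra.
  by rewrite gerBl invr_ge0 mulr_ge0 ?sqr_ge0 // ltW.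
apply: nondecreasing_is_cvgn; first exact/nondecreasing_series.
exists 2 => _ [[|N] _ <-]; first by rewrite /series /= big_geq.
by apply: le_trans (B N) _; rewrite gerBl invr_ge0.
Qed.

(** Telescoping of ln(1 + x) <= x at x = -1/(k+1); the lower bound below uses x = 1/k instead. *)
Lemma pharm1_ln_ub (R : realType) (N p : nat) : (0 < N)%N ->
  pharm R 1 (N + p) - pharm R 1 N <= ln (N + p)%:R - ln N%:R.
Proof.
move=> N0; elim: p => [|p IH]; first by rewrite addn0 !subrr.
rewrite addnS pharmS expr1.
have k0 : 0 < (N + p)%:R :> R by rewrite ltr0n addn_gt0 N0.
have k1 : 0 < (N + p).+1%:R :> R by rewrite ltr0n.
suff H : (N + p).+1%:R^-1 <= ln (N + p).+1%:R - ln (N + p)%:R :> R.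
  by rewrite addrAC (le_trans (lerD IH H)) // addrC addrA subrK.
rewrite -[leRHS]opprB lerNr -ln_div ?posrE //.
have -> : (N + p)%:R / (N + p).+1%:R = 1 + - (N + p).+1%:R^-1 :> R.
  by rewrite -[X in X / _](addrK 1) natr1 mulrBl mul1r mulfV ?gt_eqF.
by apply: le_ln1Dx; rewrite ltrN2 invf_lt1 ?posrE // ltr1n ltnS addn_gt0 N0.
Qed.

Lemma pharm1_ln_lb (R : realType) (N p : nat) :
  ln (N + p).+1%:R - ln N.+1%:R <= pharm R 1 (N + p) - pharm R 1 N.
Proof.
elim: p => [|p IH]; first by rewrite addn0 !subrr.
rewrite addnS pharmS expr1.
have k1 : 0 < (N + p).+1%:R :> R by rewrite ltr0n.
suff H : ln (N + p).+2%:R - ln (N + p).+1%:R <= (N + p).+1%:R^-1 :> R.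
  by rewrite [leRHS]addrAC (le_trans _ (lerD IH H)) // [leRHS]addrC addrA subrK.
rewrite -ln_div ?posrE //.
have -> : (N + p).+2%:R / (N + p).+1%:R = 1 + (N + p).+1%:R^-1 :> R.
  by rewrite -[(N + p).+2%:R]natr1 mulrDl mul1r mulfV ?gt_eqF.
by apply: le_ln1Dx; rewrite (lt_trans (ltrN10 R)) // invr_gt0.
Qed.

Lemma cvg_pharm1 (R : realType) :
  pharm R 1 (2 * N) - pharm R 1 N @[N --> \oo] --> ln (2 : R).
Proof.
rewrite -cvg_shiftS.
have L N : ln ((2 * N.+1)%:R : R) - ln N.+1%:R = ln 2.
  by rewrite natrM lnM ?posrE ?ltr0n // addrK.
apply: (@squeeze_cvgr _ _ _ _ (fun N => ln 2 - harmonic N) (fun=> ln 2)).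
- apply: nearW => N; rewrite /= -(L N) mul2n -addnn pharm1_ln_ub // andbT.
  apply: le_trans (pharm1_ln_lb _ _ _); rewrite /harmonic /=.
  rewrite -addrA -opprD lerB //; first by rewrite ler_ln ?posrE ?ltr0n // ler_nat.
  (* Taking p = 1 gives ln(N+2) - ln(N+1) <= 1/(N+1), which is [harmonic N]. *)
  have := pharm1_ln_lb R N 1.
  by rewrite addn1 pharmS expr1 [pharm R 1 N + _]addrC addrK lerBlDl.
- rewrite -[X in _ --> X]subr0; apply: cvgB; first exact: cvg_cst.
  exact: cvg_harmonic.
- exact: cvg_cst.
Qed.

(** * The limit of the truncated product *)

Lemma zlogder_gamma_trunc (R : realType) (M N : nat) :
  exists x : {poly R}, [/\ zlogder M x (gamma_trunc R M N), x`_0 = 0 &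
    forall j, (j.+1 < M)%N -> x`_j.+1 =
      (-1) ^+ j * (2 ^+ j.+1 * pharm R j.+1 (2 * N) - 2 * pharm R j.+1 N)].
Proof.
pose t (c : R) := c *: 'X * geom M c.
(* Each factor (1 + c z)/(1 + d z) contributes c z/(1 + c z) - d z/(1 + d z). *)
exists (\sum_(k < N) (t (k%:R + 2^-1)^-1 - t k.+1%:R^-1)); split.
- apply: (zlogder_prod _ _ _ (fun k => t (k%:R + 2^-1)^-1 - t k.+1%:R^-1)
    (fun k => (1 + (k%:R + 2^-1)^-1 *: 'X) * geom M (k.+1%:R^-1))) => k.
  by apply: zlogderM (zlogder_linear _ _ _) (zlogder_geom _ _ _).
- rewrite coef_sum big1 // => k _.
  by rewrite coefB /t -!scalerAl !coefZ !coefXM !mulr0 subrr.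
move=> j jM; rewrite -pharm_half mulr_sumr coef_sum; apply: eq_bigr => k _.
have tE c : (t c)`_j.+1 = (-1) ^+ j * c ^+ j.+1.
  rewrite /t -scalerAl coefZ coefXM /= coef_poly (ltnW jM) exprS.
  by rewrite [(- c) ^+ j]exprNn mulrCA.
by rewrite coefB !tE mulrBr.
Qed.

Definition Carg (R : realType) (j : nat) : R :=
  if (j <= 1)%N then 0 else (-1) ^+ j * (j.-1)`!%:R * zeta j%:R.

Definition Darg (R : realType) (j : nat) : R :=
  if (j <= 1)%N then 0 else (-1) ^+ j.-1 * (j.-1)`!%:R * zeta j%:R.

(** [Cpoly], [Dpoly] and [Epoly] truncate Gamma(1+z) e^(gamma z), 1/(Gamma(1+2z) e^(2 gamma z)) and
    4^z. In C^2 D E the exponentials of gamma cancel. *)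
Definition Cpoly (R : realType) (M : nat) : {poly R} :=
  \poly_(k < M) (Cbell R k / k`!%:R).

Definition Dpoly (R : realType) (M : nat) : {poly R} :=
  \poly_(k < M) (2 ^+ k * (Dbell R k / k`!%:R)).

Definition Epoly (R : realType) (M : nat) : {poly R} :=
  \poly_(k < M) ((2 * ln 2) ^+ k / k`!%:R).

Lemma bellY0 (R : realType) (x : nat -> R) : bellY x 0 = 1.
Proof.
by rewrite /bellY big_ord1 fact0 invr1 scale1r expr0 coef1 mul1r.
Qed.

Lemma gamma_trunc_cvg (R : realType) (M m : nat) : (m < M)%N ->
  (gamma_trunc R M N)`_m @[N --> \oo] -->
    (Cpoly R M * Cpoly R M * Dpoly R M * Epoly R M)`_m.
Proof.
move=> mM; have M0 : (0 < M)%N by case: M mM.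
have /choice[x xP] := zlogder_gamma_trunc R M.
pose bp (a : nat -> R) : {poly R} :=
  \poly_(j < M) (if j == 0%N then 0 else a j / (j.-1)`!%:R).
have HC : zlogder M (bp (Carg R)) (Cpoly R M) := zlogder_bell R (Carg R) M.
have HD : zlogder M (\poly_(j < M) (2 ^+ j * (bp (Darg R))`_j)) (Dpoly R M).
  apply: zlogder_eqr (zlogder_scale _ _ 2 _ _ (zlogder_bell R (Darg R) M)).
  by move=> i iM; rewrite !coef_poly iM.
have HE : zlogder M ((2 * ln 2) *: 'X) (Epoly R M) := zlogder_exp R M (2 * ln 2).
have HV := zlogderM _ _ _ _ _ _ (zlogderM _ _ _ _ _ _ (zlogderM _ _ _ _ _ _ HC HC) HD) HE.
apply: (zlogder_cvg _ _ x _ _ _ _ HV) => //.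
- by move=> N; have [] := xP N.
- by move=> N; have [] := xP N.
- by move=> N; exact: gamma_trunc0.
- by rewrite !coefD coefZ coefX !coef_poly M0 !mulr0 !addr0.
- rewrite !coef0M !coef_poly M0 /= /Cbell /Dbell !bellY0 !expr0 fact0.
  by rewrite divr1 !mulr1.
case=> [//|j] /= jM.
under eq_fun => N.
  have [_ _ ->//] := xP N.
  over.
rewrite !coefD coefZ coefX !coef_poly jM /= /Carg /Darg.
have cvg2N (u : R^nat) (l : R) : u N @[N --> \oo] --> l -> u (2 * N)%N @[N --> \oo] --> l.
  by move=> ul; apply: cvg_comp ul; exact: cvg_mulnl.
(* At z^1 the Bell arguments vanish and only 4^z contributes; the two harmonic sums diverge
   separately, so their difference is kept together. *)
case: j jM => [|j] jM /=.
  rewrite !mul0r mulr0 !add0r mulr1.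
  under eq_fun do rewrite expr0 mul1r expr1 -mulrBr.
  by apply: cvgMl_tmp; exact: cvg_pharm1.
have f0 : (j.+1)`!%:R != 0 :> R by rewrite pnatr_eq0 -lt0n fact_gt0.
have P := cvg_pharm R j.+2 isT.
(* The two copies of C give the -2 zeta and the rescaled D gives the 2^j zeta. *)
have -> : (-1) ^+ j.+2 * (j.+1)`!%:R * zeta j.+2%:R / (j.+1)`!%:R +
    (-1) ^+ j.+2 * (j.+1)`!%:R * zeta j.+2%:R / (j.+1)`!%:R +
    2 ^+ j.+2 * ((-1) ^+ j.+1 * (j.+1)`!%:R * zeta j.+2%:R / (j.+1)`!%:R) +
    2 * ln 2 * 0
  = (-1) ^+ j.+1 * (2 ^+ j.+2 * zeta j.+2%:R - 2 * zeta (j.+2%:R : R)).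
  move: (j.+1`!%:R) f0 (zeta _) => f f0 z; rewrite [(-1) ^+ j.+2]exprS.
  by field.
apply: cvgMl_tmp; apply: cvgB; apply: cvgMl_tmp => //.
exact: cvg2N.
Qed.

(** * Coefficients of the limit and the sum of the series *)

Lemma coef_poly_prod4 (R : comNzRingType) (n m : nat) (a b c d : nat -> R) :
  ((\poly_(i < n) a i) * (\poly_(i < n) b i) * (\poly_(i < n) c i)
     * (\poly_(i < n) d i))`_m =
  \sum_(i < n) \sum_(j < n) \sum_(k < n) \sum_(l < n | (i + j + k + l == m)%N)
    a i * b j * c k * d l.
Proof.
rewrite !poly_def -!mulrA mulr_suml coef_sum; apply: eq_bigr => i _.
rewrite mulr_suml mulr_sumr coef_sum; apply: eq_bigr => j _.
rewrite mulr_suml !mulr_sumr coef_sum; apply: eq_bigr => k _.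
rewrite !mulr_sumr coef_sum [RHS]big_mkcond; apply: eq_bigr => l _ /=.
rewrite -!(scalerAr, scalerAl) -!exprD !coefZ !addnA coefXn eq_sym.
by case: eqP => _; rewrite ?mulr0 // mulr1; ring.
Qed.

Lemma coef_CCDE (R : realType) (q m : nat) :
  (Cpoly R q * Cpoly R q * Dpoly R q * Epoly R q)`_m =
  \sum_(k1 < q) \sum_(k2 < q) \sum_(k3 < q)
       \sum_(k4 < q | (k1 + k2 + k3 + k4 == m)%N) G R k1 k2 k3 k4.
Proof.
rewrite coef_poly_prod4.
do 3! [apply: eq_bigr => ? _]; apply: eq_bigr => k4 _.
rewrite /G exprD exprMn !invfM; ring.
Qed.

Lemma binom_series_cvg (R : realType) (m : nat) :
  binom_series R m.+2 N @[N --> \oo] -->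
    (-1) ^+ m * (Cpoly R m.+2 * Cpoly R m.+2 * Dpoly R m.+2 * Epoly R m.+2)`_m.+1.
Proof.
set L := _ * _.
have dL : dsum R N m.+1 @[N --> \oo] --> L.
  rewrite (_ : (fun N => _) = fun N => (-1) ^+ m * (gamma_trunc R m.+2 N)`_m.+1).
    by apply: cvgMl_tmp; exact: gamma_trunc_cvg.
  by apply/funext => N; rewrite gamma_trunc_coef // mulrA -expr2 sqrr_sign mul1r.
(* The partial sum [binom_series] stops before N, whereas [dsum] includes n = N. *)
rewrite -cvg_shiftS.
apply: (@squeeze_cvgr _ _ _ _ (fun N => dsum R N m.+1 - (N%:R * cbin R N)^-1)
  (fun N => dsum R N m.+1)) => //.
- near=> N; rewrite lerBlDr binom_series_le_dsum andbT.
  by apply: dsum_le_binom_series; near: N; exact: nbhs_infty_gt.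
- rewrite -[L]subr0; apply: cvgB => //; exact: cvg_inv_mul_cbin.
Unshelve. all: by end_near. Qed.


(** * Membership in the ring generated by ln 2 and the zeta values *)

Lemma bellY_subring (R : realType) (S : subringClosed R) (x : nat -> R) (n : nat) :
  (forall r, ratr r \in S) -> (forall j, x j \in S) -> bellY x n \in S.
Proof.
move=> ratS xS.
(* A subring need not be closed under division; these reciprocals are rational. *)
have invS k : (k%:R : R)^-1 \in S.
  by have := ratS k%:R^-1; rewrite fmorphV rmorph_nat.
rewrite /bellY rpredM ?rpred_nat //; apply/polyOverP.
apply: rpred_sum => m _; rewrite polyOverZ ?invS // rpredX //.
by apply: polyOver_poly => k _; case: ifP => _; rewrite ?rpred0 ?rpredM.
Qed.

Lemma G_subring (R : realType) (S : subringClosed R) (k1 k2 k3 k4 : nat) :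
  (forall r, ratr r \in S) -> (ln 2 : R) \in S ->
  (forall j, (2 <= j)%N -> (zeta j%:R : R) \in S) -> G R k1 k2 k3 k4 \in S.
Proof.
move=> ratS ln2S zetaS.
rewrite /G rpredM //; last first.
  rewrite -!natrM; have := ratS (k1`! * k2`! * k3`! * k4`!)%:R^-1.
  by rewrite fmorphV rmorph_nat.
have xS j e : (if (j <= 1)%N then 0 else (-1) ^+ e * (j.-1)`!%:R * zeta j%:R)
    \in (S : {pred R}).
  case: leqP => j1; first exact: rpred0.
  by rewrite !rpredM ?rpredX ?rpredN1 ?rpred_nat ?zetaS.
have CS k : Cbell R k \in S by apply: bellY_subring => // j; exact: xS.
have DS k : Dbell R k \in S by apply: bellY_subring => // j; exact: xS.
apply: rpredM (DS _); apply: rpredM (CS _); apply: rpredM (CS _).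
by rewrite rpredM ?rpredX ?rpred_nat.
Qed.

Theorem theorem3p4 (R : realType) (q : nat) (hq : (2 <= q)%N) :
  (binom_series R q N @[N --> \oo] -->
     (-1) ^+ q * \sum_(k1 < q) \sum_(k2 < q) \sum_(k3 < q)
       \sum_(k4 < q | (k1 + k2 + k3 + k4 == q - 1)%N) G R k1 k2 k3 k4)
  /\ Qadjoin (ln2_zetas R) (limn (binom_series R q)).
Proof.
set L := _ * _.
have cvgL : binom_series R q N @[N --> \oo] --> L.
  case: q @L hq => [|[|m]] // L _.
  have := binom_series_cvg R m; rewrite coef_CCDE /L subn1.
  by rewrite [(-1) ^+ m.+2]exprS [(-1) ^+ m.+1]exprS !mulN1r opprK.
split=> //; rewrite (cvg_lim _ cvgL) //.
(* [smallest] is an intersection, so L is placed in an arbitrary subring A containing the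
   generators. *)
move=> A [/= closedA genA].
pose closed_mixin := GRing.isSubringClosed.Build R (mem A) closedA.
pose S : subringClosed R := HB.pack (pred_of_simpl (mem A)) closed_mixin.
have genS x : (range (@ratr R) `|` ln2_zetas R) x -> x \in S.
  by move=> /genA Ax; exact: mem_set.
suff : L \in S by exact: set_mem.
rewrite /L rpredM ?rpredX ?rpredN1 //.
do 4! apply: rpred_sum => ? _; apply: G_subring.
- by move=> r; apply: genS; left; exists r.
- by apply: genS; right; left.
- by move=> j j2; apply: genS; right; right; exists j.
Qed.
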